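(* Let $k\geq 1$ be an integer, let $q$ be a power of an odd prime, and let $E\subset\mathbb{F}_q^2$ satisfy $|E|\gtrsim q^{s}$, where $s=2-\frac{1}{k+1}$. Then $|\mathcal{C}_{k+1}(E)|\gtrsim |\mathcal{C}_{k+1}(\mathbb{F}_q^2)|$.
   Context: For a commutative ring $R$ and $x=(x_1,x_2),y=(y_1,y_2)\in R^2$, write $y^\perp=(y_2,-y_1)$, so $x\cdot y^\perp=x_1y_2-x_2y_1$. A $(k+1)$-point configuration is an element $x=(x^1,\dots,x^{k+1})\in (R^2)^{k+1}$. For $E\subset R^2$, define an equivalence relation $\sim$ on $E^{k+1}$ by $x\sim y$ iff $x^i\cdot x^{j\perp}=y^i\cdot y^{j\perp}$ for every pair of indices $i,j$; $\mathcal{C}_{k+1}(E)$ denotes the set of equivalence classes of $E^{k+1}$ under $\sim$. The notation $X\lesssim Y$ (equivalently $Y\gtrsim X$) means $X\leq CY$ for a constant $C$ independent of $q$ and $E$ (it may depend on $k$); the hypothesis $|E|\gtrsim q^s$ means $|E|\geq Cq^s$ for a sufficiently large such constant. *)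

(* Defs.v *)
From HB Require Import structures.
From mathcomp Require Import all_boot all_order all_algebra.
From mathcomp Require Import all_classical all_reals all_analysis.
Set Implicit Arguments. Unset Strict Implicit. Unset Printing Implicit Defensive.
Import Order.TTheory GRing.Theory Num.Theory.
Local Open Scope ring_scope.

Definition dot2 (F : fieldType) (x y : F * F) : F := x.1 * y.1 + x.2 * y.2.
Definition perp2 (F : fieldType) (y : F * F) : F * F := (y.2, - y.1).

Definition config (F : finFieldType) (k : nat) := {ffun 'I_k.+1 -> (F * F)%type}.

Definition configs (F : finFieldType) (k : nat) (E : {set F * F}) : {set config F k} :=
  [set x : config F k | [forall i, x i \in E]].

Definition cfg_equiv (F : finFieldType) (k : nat) (x y : config F k) : bool :=
  [forall i, forall j, dot2 (x i) (perp2 (x j)) == dot2 (y i) (perp2 (y j))].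

Definition cfg_classes (F : finFieldType) (k : nat) (E : {set F * F})
  : {set {set config F k}} :=
  [set [set y in configs k E | cfg_equiv x y] | x in configs k E].

(* Main.v *)
Require Import Defs.
From HB Require Import structures.
From mathcomp Require Import all_boot all_order all_algebra.
From mathcomp Require Import all_classical all_reals all_analysis.
From mathcomp Require Import ring lra zify.
Import Order.TTheory GRing.Theory Num.Theory.
Local Open Scope ring_scope.

(* Write n = k + 1, m = |E \ {0}|, and f(g) = |E ∩ g^-1 E| for g in SL_2(F_q).
   Configurations whose first two points are independent are equivalent iff they
   lie in one SL_2-orbit, so Cauchy-Schwarz over the classes gives
   m^(2n) <~ |C(E)| * sum_g f(g)^n.  The function f has mean about m^2/q^2 and
   variance sum_g (f(g) - m^2/q^2)^2 <= 2 q^2 m^2: expanding the square reduces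
   this to a second moment of the determinant form on E x E, which is bounded by
   a second moment of point-line incidences.  Splitting according to whether
   f(g) <= 2 m^2/q^2 and using f <= m otherwise,
   sum_g f(g)^n <~ m^(2n)/q^(2n-3) + q^2 m^n, and the first term dominates
   exactly when m >~ q^(2-1/n).  Finally |C(F_q^2)| <~ q^(2n-3). *)

(** * The determinant form, the action of SL_2 and transporter counts *)

Definition det2 {F : fieldType} (x y : F * F) : F := x.1 * y.2 - x.2 * y.1.

Lemma dot2_perp2 (F : fieldType) (x y : F * F) : dot2 x (perp2 y) = det2 x y.
Proof. by rewrite /dot2 /perp2 /det2 mulrN. Qed.

(** Row-vector convention: the pair [g] lists the two rows of a matrix, which multiplies the row
    vector [x] from the right. *)
Definition mact {F : fieldType} (g : (F * F) * (F * F)) (x : F * F) : F * F :=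
  (x.1 * g.1.1 + x.2 * g.2.1, x.1 * g.1.2 + x.2 * g.2.2).

Definition SL2 (F : finFieldType) : {set (F * F) * (F * F)} :=
  [set g | det2 g.1 g.2 == 1].

Lemma pair_eq0 (F : fieldType) (x : F * F) :
  (x == 0) = (x.1 == 0) && (x.2 == 0).
Proof. by []. Qed.

Lemma det2_mact (F : fieldType) (g : (F * F) * (F * F)) (x y : F * F) :
  det2 (mact g x) (mact g y) = det2 g.1 g.2 * det2 x y.
Proof. by rewrite /det2 /mact /=; ring. Qed.

Lemma card_line (F : finFieldType) (x : F * F) (t : F) : x != 0 ->
  #|[set v | det2 x v == t]| = #|F|.
Proof.
case: x => a b; rewrite pair_eq0 /= => x0.
have [a0|a0] := eqVneq a 0.
  have b0 : b != 0 by move: x0; rewrite a0 eqxx.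
  have -> : [set v | det2 (a, b) v == t] = [set (- t / b, s) | s in [set: F]].
    apply/setP => -[v1 v2]; rewrite inE /det2 /= a0; apply/eqP/imsetP.
      by move=> <-; exists v2 => //; congr pair; field.
    by case=> s _ [-> ->]; field.
  by rewrite card_imset ?cardsT // => s s' [].
have -> : [set v | det2 (a, b) v == t] = [set (s, (t + b * s) / a) | s in [set: F]].
  apply/setP => -[v1 v2]; rewrite inE /det2 /=; apply/eqP/imsetP.
    by move=> <-; exists v1 => //; congr pair; field.
  by case=> s _ [-> ->]; field.
by rewrite card_imset ?cardsT // => s s' [].
Qed.

Lemma det2C (F : fieldType) (x y : F * F) : det2 x y = - det2 y x.
Proof. by rewrite /det2; ring. Qed.

(** A nonzero coordinate of x lets one row of g be solved for in terms of the other. The condition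
    det g = 1 then confines the remaining row to an affine line in the direction of y, counted by
    [card_line]. *)
Lemma card_SL2_transporter (F : finFieldType) (x y : F * F) :
  x != 0 -> y != 0 -> #|[set g in SL2 F | mact g x == y]| = #|F|.
Proof.
case: x => a b; rewrite pair_eq0 /= => x0 y0.
have [a0|a0] := eqVneq a 0.
  have b0 : b != 0 by move: x0; rewrite a0 eqxx.
  rewrite -(card_line _ y (- b) y0).
  have -> : [set g in SL2 F | mact g (a, b) == y]
     = [set (v, (y.1 / b, y.2 / b)) | v in [set v | det2 y v == - b]].
    apply/setP => -[[u1 u2] [v1 v2]]; rewrite !inE /=; apply/andP/imsetP.
      case=> /eqP h /eqP <-; rewrite /mact /= a0.
      exists (u1, u2); last by congr (_, (_, _)); field.
      rewrite inE /det2 /=; apply/eqP; move: h; rewrite /det2 /= => h.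
      by rewrite -[in RHS](mulr1 b) -h; ring.
    case=> -[w1 w2]; rewrite inE /det2 /= => /eqP h [-> -> -> ->] /=.
    split; last by rewrite /mact /= a0; apply/eqP; case: (y) => ? ? /=; congr pair; field.
    apply/eqP; apply: (mulfI b0); rewrite mulr1 -[RHS]opprK -h; field.
    exact: b0.
  by rewrite card_imset // => s s' [].
rewrite -(card_line _ y a y0).
have -> : [set g in SL2 F | mact g (a, b) == y]
   = [set (((y.1 - b * v.1) / a, (y.2 - b * v.2) / a), v) | v in [set v | det2 y v == a]].
  apply/setP => -[[u1 u2] [v1 v2]]; rewrite !inE /=; apply/andP/imsetP.
    case=> /eqP h /eqP <-; rewrite /mact /=.
    exists (v1, v2); last by congr ((_, _), _) => /=; field.
    rewrite inE /det2 /=; apply/eqP; move: h; rewrite /det2 /= => h.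
    by rewrite -[in RHS](mulr1 a) -h; ring.
  case=> -[w1 w2]; rewrite inE /det2 /= => /eqP h [-> -> -> ->] /=.
  split; last by rewrite /mact /=; apply/eqP; case: (y) => ? ? /=; congr pair; field.
  apply/eqP; apply: (mulfI a0); rewrite mulr1 -[RHS]h; field.
  exact: a0.
by rewrite card_imset // => s s' [].
Qed.

(* Cramer's rule for the linear map sending the frame (x, y) to (x', y'). *)
Definition frame_map {F : fieldType} (x y x' y' : F * F) : (F * F) * (F * F) :=
  (((y.2 * x'.1 - x.2 * y'.1) / det2 x y, (y.2 * x'.2 - x.2 * y'.2) / det2 x y),
   ((x.1 * y'.1 - y.1 * x'.1) / det2 x y, (x.1 * y'.2 - y.1 * x'.2) / det2 x y)).

Lemma frame_map_mact (F : fieldType) (g : (F * F) * (F * F)) (x y : F * F) :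
  det2 x y != 0 -> frame_map x y (mact g x) (mact g y) = g.
Proof.
case: g x y => [[a b] [c d]] [x1 x2] [y1 y2]; rewrite /det2 /= => xy0.
by rewrite /frame_map /mact /det2 /=; congr ((_, _), (_, _)); field.
Qed.

Lemma frame_map_det (F : fieldType) (x y x' y' : F * F) :
  det2 x y != 0 -> det2 x' y' = det2 x y ->
  det2 (frame_map x y x' y').1 (frame_map x y x' y').2 = 1.
Proof.
case: x y x' y' => [x1 x2] [y1 y2] [a b] [c d] xy0 e.
transitivity (det2 (a, b) (c, d) / det2 (x1, x2) (y1, y2)); last by rewrite e divff.
by move: xy0 => {e}; rewrite /frame_map /det2 /= => xy0; field.
Qed.

(** Since det(x,y) z = det(x,z) y - det(y,z) x, the coordinates of z in the frame (x, y) depend on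
    determinants only, so z' has the same coordinates in the frame (x', y'). This is what turns
    equivalence of configurations into membership in one orbit. *)
Lemma mact_frame_map (F : fieldType) (x y x' y' z z' : F * F) :
  det2 x y != 0 -> det2 x' y' = det2 x y ->
  det2 x' z' = det2 x z -> det2 y' z' = det2 y z ->
  mact (frame_map x y x' y') z = z'.
Proof.
move=> xy0 exy exz eyz.
transitivity ((det2 x z * y'.1 - det2 y z * x'.1) / det2 x y,
              (det2 x z * y'.2 - det2 y z * x'.2) / det2 x y).
  by move: xy0; rewrite /mact /frame_map /det2 /= => xy0; congr pair; field.
rewrite -exz -eyz -exy; move: xy0; rewrite -exy.
case: x' y' z' {exy exz eyz} => [x1 x2] [y1 y2] [z1 z2]; rewrite /det2 /= => xy0.
by congr pair; field.
Qed.

(** The boolean bound reads as 0 or 1: elements of SL_2 preserve determinants, and the images of an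
    independent frame determine g through [frame_map]. *)
Lemma card_SL2_transporter2 (F : finFieldType) (x y x' y' : F * F) :
  det2 x y != 0 ->
  (#|[set g in SL2 F | (mact g x == x') && (mact g y == y')]|
     <= (det2 x y == det2 x' y'))%N.
Proof.
move=> xy0; have [e|/eqP ne] := eqVneq (det2 x y) (det2 x' y'); last first.
  rewrite leqn0 cards_eq0; apply/eqP/setP => g; rewrite !inE.
  apply/negP => /and3P[/eqP h /eqP gx /eqP gy]; apply: ne.
  by rewrite -gx -gy det2_mact h mul1r.
rewrite -[leqRHS]/1%N -(cards1 (frame_map x y x' y')); apply: subset_leq_card; apply/fintype.subsetP => g.
rewrite !inE => /and3P[_ /eqP <- /eqP <-].
by rewrite frame_map_mact.
Qed.

Lemma pair_det2_eq0 (F : fieldType) (x y : F * F) : x != 0 -> det2 x y = 0 ->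
  exists l, y = (l * x.1, l * x.2).
Proof.
case: x y => [a b] [c d]; rewrite pair_eq0 /det2 /= => x0 /eqP.
rewrite subr_eq0 => /eqP h.
have [a0|a0] := eqVneq a 0.
  have b0 : b != 0 by move: x0; rewrite a0 eqxx.
  exists (d / b); congr pair; last by field.
  apply: (mulfI b0); rewrite -h a0; ring.
exists (c / a); congr pair; first by field.
by apply: (mulfI a0); rewrite h; field.
Qed.

Lemma card_SL2_le (F : finFieldType) : (#|SL2 F| <= #|F| ^ 3)%N.
Proof.
rewrite -sum1_card (eq_bigl (fun g => det2 g.1 g.2 == 1)); last by move=> g; rewrite inE.
rewrite big_mkcond /= -(pair_bigA _ (fun u v : F * F => if det2 u v == 1 then 1%N else 0%N)) /=.
have -> : (#|F| ^ 3 = \sum_(u : F * F) #|F|)%N.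
  by rewrite sum_nat_const card_prod !expnS expn0 muln1 mulnA.
apply: leq_sum => u _; rewrite -big_mkcond /= sum1_card.
have [->|u0] := eqVneq u 0; last by rewrite -(card_line _ u 1 u0) cardsE.
rewrite eq_card0 // => v; rewrite unfold_in /det2 /= !mul0r subrr; apply/eqP => /esym/eqP.
by rewrite oner_eq0.
Qed.

(** * Indicator sums, variances and Cauchy-Schwarz *)

Lemma natr_card_indic (R : realFieldType) (T : finType) (A : {set T}) (P : pred T) :
  #|[set x in A | P x]|%:R = \sum_(x in A) (P x)%:R :> R.
Proof.
rewrite -sum1_card natr_sum big_mkcond [RHS]big_mkcond.
by apply: eq_bigr => x _; rewrite inE; case: (x \in A); case: (P x).
Qed.

Lemma natr_card_indicT (R : realFieldType) (T : finType) (P : pred T) :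
  #|[set x | P x]|%:R = \sum_x (P x)%:R :> R.
Proof.
rewrite -sum1_card natr_sum big_mkcond.
by apply: eq_bigr => x _; rewrite inE; case: (P x).
Qed.

Lemma sum_eq_indic (R : realFieldType) (T : finType) (a : T) :
  \sum_t (a == t)%:R = 1 :> R.
Proof. by rewrite -natr_card_indicT (eq_card (B := pred1 a)) ?card1 // => t; rewrite !inE eq_sym. Qed.

Lemma sum_eq_indicM (R : realFieldType) (T : finType) (a b : T) :
  \sum_t (a == t)%:R * (b == t)%:R = (a == b)%:R :> R.
Proof.
rewrite (bigD1 b) //= eqxx mulr1 big1 ?addr0 // => t tb.
by rewrite [b == t]eq_sym (negbTE tb) mulr0.
Qed.

Lemma sum_sqr_variance (R : realFieldType) (T : finType) (A : {pred T}) (f : T -> R) (c : R) :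
  \sum_(t in A) (f t - c) ^+ 2 =
  \sum_(t in A) f t ^+ 2 - 2 * c * \sum_(t in A) f t + c ^+ 2 * #|A|%:R.
Proof.
rewrite (eq_bigr (fun t => f t ^+ 2 + ((- (2 * c)) * f t + c ^+ 2))); last by move=> t _; ring.
rewrite big_split big_split /= -mulr_sumr sumr_const -mulr_natr; ring.
Qed.

Lemma sumT_sqr_variance (R : realFieldType) (T : finType) (f : T -> R) (c : R) :
  \sum_t (f t - c) ^+ 2 =
  \sum_t f t ^+ 2 - 2 * c * \sum_t f t + c ^+ 2 * #|T|%:R.
Proof. exact: (sum_sqr_variance R T predT f c). Qed.

Lemma cauchy_schwarz_sum (R : realFieldType) (T : finType) (A : {set T}) (f : T -> R) :
  (\sum_(t in A) f t) ^+ 2 <= #|A|%:R * \sum_(t in A) f t ^+ 2.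
Proof.
set S := \sum_(t in A) f t; set Q := \sum_(t in A) f t ^+ 2.
have [A0|A0] := posnP #|A|.
  by rewrite /S A0 mul0r (cards0_eq A0) big_set0 expr0n.
have n0 : 0 < #|A|%:R :> R by rewrite ltr0n.
(* The sum of squared deviations from the mean, times [#|A|], is the difference of the two sides. *)
have : 0 <= \sum_(t in A) (f t - S / #|A|%:R) ^+ 2 by apply: sumr_ge0 => t _; exact: sqr_ge0.
rewrite sum_sqr_variance -/S -/Q.
have -> : Q - 2 * (S / #|A|%:R) * S + (S / #|A|%:R) ^+ 2 * #|A|%:R
   = (#|A|%:R * Q - S ^+ 2) / #|A|%:R by field; rewrite gt_eqF.
by rewrite pmulr_lge0 ?invr_gt0 // subr_ge0.
Qed.

(** * Incidences with lines and the second moment of the determinant form *)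

Definition line_count (R : realFieldType) {F : finFieldType} (E : {set F * F})
    (x : F * F) (t : F) : R := \sum_(y in E) (det2 x y == t)%:R.
Definition area_count (R : realFieldType) {F : finFieldType} (E : {set F * F})
    (t : F) : R := \sum_(x in E) line_count R E x t.

Lemma sum_line_count (R : realFieldType) (F : finFieldType) (E : {set F * F}) x :
  \sum_t line_count R E x t = #|E|%:R.
Proof.
rewrite exchange_big /= -sum1_card natr_sum; apply: eq_bigr => y _.
exact: sum_eq_indic.
Qed.

Lemma sum_line_count_sqr (R : realFieldType) (F : finFieldType) (E : {set F * F}) x :
  \sum_t line_count R E x t ^+ 2 =
  \sum_(y in E) \sum_(z in E) (det2 x (y - z) == 0)%:R.
Proof.
transitivity (\sum_t \sum_(y in E) \sum_(z in E)
   ((det2 x y == t)%:R * (det2 x z == t)%:R : R)).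
  apply: eq_bigr => t _; rewrite expr2 /line_count mulr_suml.
  by apply: eq_bigr => y _; rewrite mulr_sumr.
rewrite exchange_big /=; apply: eq_bigr => y _.
rewrite exchange_big /=; apply: eq_bigr => z _.
rewrite sum_eq_indicM -subr_eq0; congr (_ == _)%:R; rewrite /det2 /=; ring.
Qed.

Lemma sum_det2_eq0 (R : realFieldType) (F : finFieldType) (w : F * F) :
  \sum_(x in [set~ (0 : F * F)]) (det2 x w == 0)%:R =
  (if w == 0 then #|F|%:R ^+ 2 - 1 else #|F|%:R - 1) :> R.
Proof.
rewrite (eq_bigl (fun x => x != 0)); last by move=> x; rewrite !inE.
have -> (f : F * F -> R) : \sum_(x : F * F | x != 0) f x = \sum_x f x - f 0.
  by rewrite [in RHS](bigD1 (0 : F * F)) //= addrC addrK.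
rewrite -natr_card_indicT {1 2}/det2 /= !mul0r subrr eqxx.
have [->|w0] := eqVneq w 0.
  rewrite (_ : [set x | _] = [set: F * F]) ?cardsT ?card_prod ?natrM ?expr2 //.
  by apply/setP => x; rewrite !inE /det2 /= !mulr0 subrr eqxx.
rewrite -(card_line _ w 0 w0); congr (_%:R - _); apply: eq_card => x.
by rewrite !inE det2C oppr_eq0.
Qed.

(** Expanding the square leaves a count of pairs (y, z) of points of E on a common line: each
    diagonal pair contributes q^2 - 1, every other pair only q - 1. The terms m^2 q then cancel
    against the mean, and m q^2 dominates what is left. *)
Lemma line_count_variance (R : realFieldType) (F : finFieldType) (E : {set F * F}) :
  \sum_(x in [set~ (0 : F * F)]) \sum_t (line_count R E x t - #|E|%:R / #|F|%:R) ^+ 2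
    <= #|F|%:R ^+ 2 * #|E|%:R.
Proof.
set m : R := #|E|%:R; set q : R := #|F|%:R.
have q0 : 1 <= q by rewrite ler1n; apply/card_gt0P; exists 0.
have cardN0 : #|[set~ (0 : F * F)]|%:R = q ^+ 2 - 1 :> R.
  rewrite cardsC1 card_prod -subn1 natrB ?natrM ?expr2 //.
  by rewrite muln_gt0 andbb; apply/card_gt0P; exists 0.
have H x : \sum_t (line_count R E x t - m / q) ^+ 2 =
    \sum_(y in E) \sum_(z in E) (det2 x (y - z) == 0)%:R - m ^+ 2 / q.
  rewrite sumT_sqr_variance sum_line_count sum_line_count_sqr.
  rewrite -/m -/q; field; lra.
under eq_bigr do rewrite H.
rewrite big_split /= sumr_const -mulr_natr cardN0.
rewrite exchange_big /=; under eq_bigr do rewrite exchange_big /=.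
have -> : \sum_(y in E) \sum_(z in E) \sum_(x in [set~ (0 : F * F)]) (det2 x (y - z) == 0)%:R
   = m * (q ^+ 2 - 1) + m * (m - 1) * (q - 1).
  under eq_bigr do under eq_bigr do rewrite sum_det2_eq0.
  rewrite (eq_bigr (fun=> q ^+ 2 - 1 + (m - 1) * (q - 1))).
    by rewrite sumr_const -mulr_natr -/m; ring.
  move=> y yE; rewrite (bigD1 y) //= subrr eqxx; congr (_ + _).
  rewrite (eq_bigr (fun=> q - 1)); last first.
    by move=> z /andP[_ zy]; rewrite subr_eq0 eq_sym (negbTE zy).
  rewrite sumr_const -mulr_natr mulrC; congr (_ * _).
  rewrite /m (cardD1 y) yE natrD addrAC subrr add0r; congr (_%:R).
  by apply: eq_card => z; rewrite !inE andbC.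
have m0 : 0 <= m by [].
have : m ^+ 2 / q <= m ^+ 2.
  by rewrite ler_pdivrMr ?ler_peMr ?sqr_ge0 //; lra.
have -> : - (m ^+ 2 / q) * (q ^+ 2 - 1) = - (m ^+ 2 * q) + m ^+ 2 / q by field; lra.
nra.
Qed.

(** The deviation of [area_count] from m^2/q is the sum over x in E of the deviations of
    [line_count] from m/q. Cauchy-Schwarz in x costs a factor m; as E omits the origin, the sum over
    x may then be enlarged to all nonzero x. *)
Lemma area_count_sqr (R : realFieldType) (F : finFieldType) (E : {set F * F}) :
  0 \notin E ->
  \sum_t area_count R E t ^+ 2 <=
    #|E|%:R ^+ 4 / #|F|%:R + #|F|%:R ^+ 2 * #|E|%:R ^+ 2.
Proof.
move=> E0; set m : R := #|E|%:R; set q : R := #|F|%:R.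
have q0 : 1 <= q by rewrite ler1n; apply/card_gt0P; exists 0.
have m0 : 0 <= m by [].
have : \sum_t (area_count R E t - m ^+ 2 / q) ^+ 2 <= q ^+ 2 * m ^+ 2.
  apply: (@le_trans _ _ (m * \sum_t \sum_(x in E) (line_count R E x t - m / q) ^+ 2)).
    rewrite mulr_sumr; apply: ler_sum => t _.
    apply: le_trans (cauchy_schwarz_sum _ _ _ _).
    rewrite big_split /= sumr_const -[in leRHS]mulr_natr -/m.
    by rewrite (_ : - (m / q) * m = - (m ^+ 2 / q)) //; ring.
  rewrite (_ : q ^+ 2 * m ^+ 2 = m * (q ^+ 2 * m)); last by ring.
  rewrite ler_wpM2l // exchange_big /=.
  apply: le_trans (line_count_variance _ _ _).
  rewrite [leLHS]big_mkcond [leRHS]big_mkcond; apply: ler_sum => x _.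
  have [xE|xE] := boolP (x \in E).
    rewrite !inE; case: eqVneq => // x0; by rewrite x0 (negbTE E0) in xE.
  by case: ifP => // _; apply: sumr_ge0 => t _; exact: sqr_ge0.
rewrite sumT_sqr_variance -/q.
have -> : \sum_t area_count R E t = m ^+ 2.
  rewrite exchange_big /=; under eq_bigr do rewrite sum_line_count.
  by rewrite sumr_const -[LHS]mulr_natr -expr2.
have -> : 2 * (m ^+ 2 / q) * m ^+ 2 = 2 * (m ^+ 4 / q) by field; lra.
have -> : (m ^+ 2 / q) ^+ 2 * q = m ^+ 4 / q by field; lra.
lra.
Qed.

(** * Moments over SL_2 of f(g), the cardinality of [hits E g] *)

Definition hits {F : finFieldType} (E : {set F * F}) (g : (F * F) * (F * F)) :
  {set F * F} := [set x in E | mact g x \in E].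

Lemma natr_mem_sum (R : realFieldType) (T : finType) (A : {set T}) (y : T) :
  (y \in A)%:R = \sum_(x in A) (y == x)%:R :> R.
Proof.
have [yA|yA] := boolP (y \in A).
  rewrite (bigD1 y) //= eqxx big1 ?addr0 // => x /andP[_ xy].
  by rewrite eq_sym (negbTE xy).
by rewrite big1 // => x xA; case: eqVneq => // e; rewrite e xA in yA.
Qed.

Lemma card_hits (R : realFieldType) (F : finFieldType) (E : {set F * F}) g :
  #|hits E g|%:R = \sum_(x in E) \sum_(y in E) (mact g x == y)%:R :> R.
Proof.
by rewrite natr_card_indic; apply: eq_bigr => x _; exact: natr_mem_sum.
Qed.

Lemma sum_card_hits (R : realFieldType) (F : finFieldType) (E : {set F * F}) :
  0 \notin E -> \sum_(g in SL2 F) #|hits E g|%:R = #|F|%:R * #|E|%:R ^+ 2 :> R.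
Proof.
move=> E0; under eq_bigr do rewrite card_hits.
rewrite exchange_big /=; under eq_bigr do rewrite exchange_big /=.
rewrite (eq_bigr (fun=> #|F|%:R * #|E|%:R)) => [|x xE].
  by rewrite sumr_const -[LHS]mulr_natr -mulrA -expr2.
rewrite (eq_bigr (fun=> #|F|%:R)) => [|y yE].
  by rewrite sumr_const -[LHS]mulr_natr.
by rewrite -natr_card_indic card_SL2_transporter //; apply: contraNneq E0 => <-.
Qed.

(** If x and y are independent, the determinant term suffices. If y = l x, any such g forces y' = l
    x', and then at most q elements carry x to x'; the sum over l detects this common ratio. *)
Lemma card_SL2_transporter2_le (R : realFieldType) (F : finFieldType)
    (x y x' y' : F * F) : x != 0 -> x' != 0 ->
  #|[set g in SL2 F | (mact g x == x') && (mact g y == y')]|%:R <=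
  (det2 x y == det2 x' y')%:R +
  #|F|%:R * \sum_(l : F) ((l * x.1, l * x.2) == y)%:R * ((l * x'.1, l * x'.2) == y')%:R
  :> R.
Proof.
move=> x0 x'0; have [xy0|xy0] := eqVneq (det2 x y) 0; last first.
  apply: (@le_trans _ _ (det2 x y == det2 x' y')%:R).
    by rewrite ler_nat card_SL2_transporter2.
  by rewrite lerDl mulr_ge0 // sumr_ge0.
apply: (@le_trans _ _ (#|F|%:R * \sum_(l : F)
    ((l * x.1, l * x.2) == y)%:R * ((l * x'.1, l * x'.2) == y')%:R)); last first.
  by rewrite lerDr.
have [l yE] := pair_det2_eq0 _ _ _ x0 xy0.
have [y'E|y'E] := eqVneq (l * x'.1, l * x'.2) y'.
  rewrite (bigD1 l) //= yE y'E !eqxx mulr1 mulrDr mulr1 ler_wpDr ?mulr_ge0 ?sumr_ge0 //.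
  rewrite ler_nat -(card_SL2_transporter _ x x' x0 x'0); apply: subset_leq_card.
  by apply/fintype.subsetP => g; rewrite !inE => /and3P[-> ->].
rewrite (_ : [set g in SL2 F | _] = finset.set0) ?cards0 ?mulr_ge0 ?sumr_ge0 //.
apply/setP => g; rewrite !inE; apply/negP => /and3P[_ /eqP gx /eqP gy].
move/eqP: y'E; apply; rewrite -gy -gx yE /mact /=; congr pair; ring.
Qed.

(** The square f(g)^2 counts quadruples in E with g x = x' and g y = y'. Summed over g, the
    determinant terms give the second moment of [area_count], and the proportional ones contribute
    at most q^2 for each of the m^2 pairs (x, x'). *)
Lemma sum_card_hits_sqr (R : realFieldType) (F : finFieldType) (E : {set F * F}) :
  0 \notin E ->
  \sum_(g in SL2 F) #|hits E g|%:R ^+ 2 <=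
  \sum_t area_count R E t ^+ 2 + #|F|%:R ^+ 2 * #|E|%:R ^+ 2.
Proof.
move=> E0; set q : R := #|F|%:R; set m : R := #|E|%:R.
have nz x : x \in E -> x != 0 by move=> xE; apply: contraNneq E0 => <-.
have -> : \sum_(g in SL2 F) #|hits E g|%:R ^+ 2 =
  \sum_(x in E) \sum_(x' in E) \sum_(y in E) \sum_(y' in E)
    #|[set g in SL2 F | (mact g x == x') && (mact g y == y')]|%:R :> R.
  transitivity (\sum_(g in SL2 F) \sum_(x in E) \sum_(x' in E) \sum_(y in E)
      \sum_(y' in E) ((mact g x == x') && (mact g y == y'))%:R : R).
    apply: eq_bigr => g _; rewrite expr2 {1}card_hits mulr_suml.
    apply: eq_bigr => x _; rewrite mulr_suml; apply: eq_bigr => x' _.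
    rewrite card_hits mulr_sumr; apply: eq_bigr => y _.
    by rewrite mulr_sumr; apply: eq_bigr => y' _; rewrite -mulnb natrM.
  rewrite exchange_big; apply: eq_bigr => x _.
  rewrite exchange_big; apply: eq_bigr => x' _.
  rewrite exchange_big; apply: eq_bigr => y _.
  by rewrite exchange_big; apply: eq_bigr => y' _; rewrite natr_card_indic.
have -> : \sum_t area_count R E t ^+ 2 =
  \sum_(x in E) \sum_(x' in E) \sum_(y in E) \sum_(y' in E)
    (det2 x y == det2 x' y')%:R.
  transitivity (\sum_t \sum_(x in E) \sum_(x' in E) \sum_(y in E)
      \sum_(y' in E) (det2 x y == t)%:R * (det2 x' y' == t)%:R : R).
    apply: eq_bigr => t _; rewrite expr2 {1}/area_count mulr_suml.
    apply: eq_bigr => x _; rewrite /area_count mulr_sumr; apply: eq_bigr => x' _.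
    rewrite /line_count mulr_suml; apply: eq_bigr => y _.
    by rewrite mulr_sumr.
  rewrite exchange_big; apply: eq_bigr => x _.
  rewrite exchange_big; apply: eq_bigr => x' _.
  rewrite exchange_big; apply: eq_bigr => y _.
  by rewrite exchange_big; apply: eq_bigr => y' _; rewrite sum_eq_indicM.
have -> : q ^+ 2 * m ^+ 2 = \sum_(x in E) \sum_(x' in E) q ^+ 2.
  by rewrite !sumr_const -mulrnA -[RHS]mulr_natr natrM expr2.
rewrite -big_split; apply: ler_sum => x xE /=.
rewrite -big_split; apply: ler_sum => x' x'E /=.
apply: (@le_trans _ _ (\sum_(y in E) \sum_(y' in E) ((det2 x y == det2 x' y')%:R +
  q * \sum_(l : F) ((l * x.1, l * x.2) == y)%:R * ((l * x'.1, l * x'.2) == y')%:R))).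
  apply: ler_sum => y _; apply: ler_sum => y' _.
  by apply: card_SL2_transporter2_le; exact: nz.
under [leLHS]eq_bigr do rewrite big_split /= -mulr_sumr exchange_big /=.
rewrite big_split /= lerD2l -mulr_sumr expr2 ler_wpM2l // exchange_big /=.
(* For fixed x and x', each ratio l determines both y and y', so it contributes at most 1. *)
rewrite /q -sum1_card natr_sum; apply: ler_sum => l _.
under eq_bigr do rewrite -mulr_sumr -natr_mem_sum.
rewrite -mulr_suml -natr_mem_sum -natrM ler_nat.
by case: (_ \in E); case: (_ \in E).
Qed.

(** With |SL_2| <= q^3, the three terms of the variance carry m^4/q with coefficients 1, -2 and 1.
    These cancel, leaving one q^2 m^2 from [area_count_sqr] and one from [sum_card_hits_sqr]. *)
Lemma hits_variance (R : realFieldType) (F : finFieldType) (E : {set F * F}) :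
  0 \notin E ->
  \sum_(g in SL2 F) (#|hits E g|%:R - #|E|%:R ^+ 2 / #|F|%:R ^+ 2) ^+ 2 <=
  2 * #|F|%:R ^+ 2 * #|E|%:R ^+ 2 :> R.
Proof.
move=> E0; have := sum_card_hits_sqr R F E E0; have := area_count_sqr R F E E0.
rewrite sum_sqr_variance sum_card_hits //.
set m : R := #|E|%:R; set q : R := #|F|%:R.
have q0 : 1 <= q by rewrite ler1n; apply/card_gt0P; exists 0.
have q3 : #|SL2 F|%:R <= q ^+ 3 by rewrite -natrX ler_nat card_SL2_le.
have : (m ^+ 2 / q ^+ 2) ^+ 2 * #|SL2 F|%:R <= m ^+ 4 / q.
  apply: le_trans (_ : (m ^+ 2 / q ^+ 2) ^+ 2 * q ^+ 3 <= _).
    by rewrite ler_wpM2l ?sqr_ge0.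
  by rewrite le_eqVlt; apply/orP; left; apply/eqP; field; lra.
have -> : 2 * (m ^+ 2 / q ^+ 2) * (q * m ^+ 2) = 2 * (m ^+ 4 / q) by field; lra.
lra.
Qed.

Lemma sum_card_hits_exp (R : realFieldType) (F : finFieldType) (E : {set F * F})
    (n : nat) : 0 \notin E -> #|F|%:R ^+ (2 * n + 3) <= #|E|%:R ^+ n.+2 :> R ->
  \sum_(g in SL2 F) #|hits E g|%:R ^+ n.+2 <=
  (2 ^+ n.+2 + 8) * (#|E|%:R ^+ (2 * n.+2) / #|F|%:R ^+ (2 * n + 1)) :> R.
Proof.
move=> E0; have := hits_variance R F E E0.
set m : R := #|E|%:R; set q : R := #|F|%:R; set mu := m ^+ 2 / q ^+ 2.
move=> hV hm.
have q0 : 1 <= q by rewrite ler1n; apply/card_gt0P; exists 0.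
have mu0 : 0 <= mu by rewrite divr_ge0 ?sqr_ge0.
have tmu0 : 0 <= 2 * mu by rewrite pmulr_rge0.
have m0 : 0 <= m by [].
have q3 : #|SL2 F|%:R <= q ^+ 3 by rewrite -natrX ler_nat card_SL2_le.
have [c cE] : exists c, c = (2 * mu) ^+ n.+2 by eexists.
(* When f > 2 mu, f^2 <= 4 (f - mu)^2 while f^n <= m^n; otherwise f^(n+2) <= c. Summing, c gives the
   constant 2^(n+2), and the variance bound gives 4 * 2 = 8. *)
have step g : #|hits E g|%:R ^+ n.+2 <= c +
    4 * m ^+ n * (#|hits E g|%:R - mu) ^+ 2.
  rewrite cE; set f : R := #|hits E g|%:R.
  have f0 : 0 <= f by [].
  have fm : f <= m by rewrite ler_nat subset_leq_card //; apply/fintype.subsetP => x; rewrite inE => /andP[].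
  have [h|h] := lerP f (2 * mu).
    apply: ler_wpDr; first by apply: mulr_ge0; rewrite ?sqr_ge0 // mulr_ge0 ?exprn_ge0.
    by rewrite lerXn2r ?nnegrE.
  apply: ler_wpDl; first by rewrite exprn_ge0.
  rewrite [4 * _]mulrC -mulrA -addn2 exprD.
  by rewrite ler_pM ?exprn_ge0 ?lerXn2r ?nnegrE //; nra.
apply: le_trans (ler_sum _ (fun g _ => step g)) _.
rewrite big_split /= -mulr_sumr sumr_const -[_ *+ #|SL2 F|]mulr_natr [leRHS]mulrDl.
apply: lerD.
  apply: le_trans (_ : c * q ^+ 3 <= _).
    by rewrite ler_wpM2l // cE exprn_ge0.
  rewrite le_eqVlt; apply/orP; left; apply/eqP.
  rewrite cE exprMn -mulrA; congr (_ * _).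
  rewrite /mu exprMn -exprM exprVn -exprM -mulrA; congr (_ * _).
  rewrite (_ : (2 * n.+2 = (2 * n + 1) + 3)%N); last by lia.
  by rewrite exprD; field; rewrite expf_neq0 //=; lra.
apply: le_trans (_ : 4 * m ^+ n * (2 * q ^+ 2 * m ^+ 2) <= _).
  by rewrite ler_wpM2l ?mulr_ge0 ?exprn_ge0.
have -> : 4 * m ^+ n * (2 * q ^+ 2 * m ^+ 2) = 8 * (m ^+ n.+2 * q ^+ 2).
  by rewrite [m ^+ n.+2]exprS [m ^+ n.+1]exprS; ring.
(* Here the size hypothesis enters: after clearing denominators and a factor m^(n+2), the claim is
   q^(2n+3) <= m^(n+2). *)
rewrite ler_pM2l // ler_pdivlMr ?exprn_gt0 //; last by lra.
rewrite (_ : (2 * n.+2 = n.+2 + n.+2)%N); last by lia.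
rewrite [in leRHS]exprD -mulrA -[in leLHS]exprD ler_wpM2l ?exprn_ge0 //.
by rewrite (_ : (2 + (2 * n + 1) = 2 * n + 3)%N) //; lia.
Qed.

(** * Pairs of equivalent configurations and the lower bound on classes *)

Lemma card_dep_pairs (S T : finType) (A : {set S}) (B : S -> {set T}) :
  #|[set p : S * T | (p.1 \in A) && (p.2 \in B p.1)]| = (\sum_(s in A) #|B s|)%N.
Proof.
rewrite -sum1_card.
under [RHS]eq_bigr do rewrite -sum1_card.
by rewrite pair_big_dep /=; apply: eq_bigl => p; rewrite inE.
Qed.

(* Cauchy-Schwarz over the fibres of h. *)
Lemma card_sqr_le_fibre (T T' : finType) (G : {set T}) (A : {set T'})
    (h : T -> T') : {in G, forall x, h x \in A} ->
  (#|G| ^ 2 <= #|A| * #|[set p : T * T | (p.1 \in G) && (p.2 \in [set y in G | h p.1 == h y])]|)%N.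
Proof.
move=> hA; rewrite -(ler_nat rat) natrX natrM.
rewrite (card_dep_pairs _ _ G (fun x => [set y in G | h x == h y])) natr_sum.
have -> : #|G|%:R = \sum_(a in A) \sum_(x in G) (h x == a)%:R :> rat.
  rewrite exchange_big /= -sum1_card natr_sum; apply: eq_bigr => x xG.
  by rewrite -natr_mem_sum hA.
apply: le_trans (cauchy_schwarz_sum _ _ _ _) _.
rewrite ler_wpM2l //.
under [leLHS]eq_bigr do rewrite expr2 mulr_suml.
rewrite exchange_big; apply: ler_sum => x _ /=.
under [leLHS]eq_bigr do rewrite mulr_sumr.
rewrite exchange_big natr_card_indic; apply: ler_sum => y _ /=.
rewrite -sum_eq_indicM big_mkcond; apply: ler_sum => a _.
by case: ifP => // _; rewrite -natrM.
Qed.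

(** The index [k.+1] means k + 2 points, so that two distinct leading indices always exist.
    Independence of those two points makes [frame_map] applicable. *)
Definition good {F : finFieldType} k (E : {set F * F}) : {set config F k.+1} :=
  [set x in configs k.+1 E | det2 (x ord0) (x (lift ord0 ord0)) != 0].

Lemma cfg_equivP (F : finFieldType) k (x y : config F k) :
  reflect (forall i j, det2 (x i) (x j) = det2 (y i) (y j)) (cfg_equiv x y).
Proof.
apply: (iffP 'forall_forallP) => h i j; have := h i j.
  by rewrite !dot2_perp2 => /eqP.
by rewrite !dot2_perp2 => ->.
Qed.

Lemma card_configs (F : finFieldType) k (E : {set F * F}) :
  #|configs k E| = (#|E| ^ k.+1)%N.
Proof.
rewrite -[in RHS](card_ord k.+1) -card_ffun_on; apply: eq_card => x.
by rewrite inE; apply/forallP/ffun_onP.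
Qed.

(** An equivalent pair (x, y) has y = g x with g the frame map of the leading points. All points of
    x then lie in [hits E g], so the pairs are covered by the image of the pairs (g, x). *)
Lemma card_good_pairs (F : finFieldType) k (E : {set F * F}) :
  (#|[set p : config F k.+1 * config F k.+1 |
       (p.1 \in good k E) && (p.2 \in [set y in good k E | cfg_equiv p.1 y])]|
   <= \sum_(g in SL2 F) #|hits E g| ^ k.+2)%N.
Proof.
under [leqRHS]eq_bigr do rewrite -card_configs.
rewrite -(card_dep_pairs _ _ (SL2 F) (fun g => configs k.+1 (hits E g))).
pose act (p : (F * F) * (F * F) * config F k.+1) : config F k.+1 * config F k.+1 :=
  (p.2, [ffun i => mact p.1 (p.2 i)]).
apply: leq_trans (leq_imset_card act _); apply: subset_leq_card.
apply/fintype.subsetP => -[x y]; rewrite !inE /= => /and3P[/andP[/forallP xE x01]].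
move=> /andP[/forallP yE _] /cfg_equivP xy.
set g := frame_map (x ord0) (x (lift ord0 ord0)) (y ord0) (y (lift ord0 ord0)).
have gx i : mact g (x i) = y i by apply: mact_frame_map.
apply/imsetP; exists (g, x); last by congr pair; apply/ffunP => i; rewrite ffunE gx.
rewrite !inE /= frame_map_det ?eqxx //=.
by apply/forallP => i; rewrite inE gx xE yE.
Qed.

Lemma card_bad (F : finFieldType) k (E : {set F * F}) : 0 \notin E ->
  (#|configs k.+1 E :\: good k E| <= #|F| * #|E| ^ k.+1)%N.
Proof.
move=> E0; rewrite -card_configs -cardsT.
(* A bad configuration is rebuilt from its points other than the one at index 1, which is reinserted
   as a multiple of the point at index 0; that point is nonzero because E omits the origin. *)
pose ext (p : F * config F k) : config F k.+1 :=
  [ffun i => if unlift (lift ord0 ord0) i is Some j then p.2 j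
             else (p.1 * (p.2 ord0).1, p.1 * (p.2 ord0).2)].
rewrite -cardsX; apply: leq_trans (leq_imset_card ext _); apply: subset_leq_card.
apply/fintype.subsetP => x; rewrite !inE => /andP[+ /forallP xE].
have -> : [forall i, x i \in E] by apply/forallP.
rewrite /= negbK => /eqP x01.
have x0 : x ord0 != 0 by apply: contraNneq E0 => <-.
have [l xl] := pair_det2_eq0 _ _ _ x0 x01.
have l0 : lift (lift ord0 ord0) ord0 = ord0 :> 'I_k.+2 by apply/val_inj.
apply/imsetP; exists (l, [ffun j => x (lift (lift ord0 ord0) j)]).
  by rewrite !inE /=; apply/forallP => j; rewrite ffunE.
apply/ffunP => i; rewrite ffunE /=; case: unliftP => [j ->|->]; first by rewrite ffunE.
by rewrite !ffunE l0.
Qed.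

Lemma card_good (F : finFieldType) k (E : {set F * F}) : 0 \notin E ->
  (2 * #|F| <= #|E|)%N -> (#|E| ^ k.+2 <= 2 * #|good k E|)%N.
Proof.
move=> E0 hE; have := card_bad F k E E0.
have sG : good k E \subset configs k.+1 E.
  by apply/fintype.subsetP => x; rewrite !inE => /andP[].
have := subset_leq_card sG.
rewrite cardsD (finset.setIidPr sG) card_configs.
have : (2 * #|F| * #|E| ^ k.+1 <= #|E| ^ k.+2)%N by rewrite [leqRHS]expnS leq_mul2r hE orbT.
set a := (#|E| ^ k.+2)%N; set b := (#|E| ^ k.+1)%N; nia.
Qed.

(** Two sets appear because the origin has to be removed for the counting, in E', while the classes
    counted are those of E. *)
Lemma card_good_sqr_le (F : finFieldType) k (E E' : {set F * F}) : E' \subset E ->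
  (#|good k E'| ^ 2 <= #|cfg_classes k.+1 E| * \sum_(g in SL2 F) #|hits E' g| ^ k.+2)%N.
Proof.
move=> sE.
have sG x : x \in good k E' -> x \in configs k.+1 E.
  by rewrite !inE => /andP[/forallP h _]; apply/forallP => i; exact: (fintype.subsetP sE).
pose h x := [set y in configs k.+1 E | cfg_equiv x y].
apply: leq_trans (card_sqr_le_fibre _ _ (good k E') (cfg_classes k.+1 E) h _) _.
  by move=> x xG; apply: imset_f; exact: sG.
rewrite leq_mul2l; apply/orP; right; apply: leq_trans (card_good_pairs _ _ _).
apply: subset_leq_card; apply/fintype.subsetP => -[x y]; rewrite !inE /=.
move=> /andP[-> /andP[yG /eqP hxy]] /=.
have yG' : y \in good k E' by rewrite !inE.
have : y \in h y by rewrite inE sG //=; apply/cfg_equivP.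
by rewrite -hxy inE => /andP[_ ->]; rewrite andbT; move: yG'; rewrite !inE.
Qed.

(** * Upper bound for the number of classes of the whole plane *)

Definition normal_cfg {F : finFieldType} k (i j : 'I_k.+2) : {set config F k.+1} :=
  [set x : config F k.+1 | (x i == (1, 0)) && ((x j).1 == 0)].

(** Point i is fixed, point j keeps one free coordinate, and the other k points are unrestricted. *)
Lemma card_normal_cfg (F : finFieldType) k (i j : 'I_k.+2) : i != j ->
  #|@normal_cfg F k i j| = (#|F| ^ (2 * k + 1))%N.
Proof.
move=> ij.
pose B (l : 'I_k.+2) : {set F * F} :=
  if l == i then [set (1, 0)] else if l == j then [set v | v.1 == 0] else [set: F * F].
have -> : #|@normal_cfg F k i j| = #|family (fun l => mem (B l))|.
  apply: eq_card => x; rewrite inE; apply/andP/familyP => [[/eqP xi xj] l|h].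
    by rewrite /B; do 2?[case: eqVneq => [->|_]]; rewrite ?inE ?xi.
  have := h i; have := h j; rewrite /B !eqxx [j == i]eq_sym (negbTE ij) !inE.
  by move=> -> ->.
rewrite card_family foldrE big_image /= (bigD1 i) //= (bigD1 j) 1?eq_sym //=.
have -> : #|B i| = 1%N by rewrite /B eqxx cards1.
have -> : #|B j| = #|F|.
  rewrite /B eqxx [j == i]eq_sym (negbTE ij) -(card_line F (0, 1) 0).
    by apply: eq_card => v; rewrite !inE /det2 /= mul0r mul1r sub0r oppr_eq0.
  by rewrite pair_eq0 /= oner_eq0 andbF.
rewrite (eq_bigr (fun=> (#|F| ^ 2)%N)); last first.
  by move=> l /andP[/negbTE li /negbTE lj]; rewrite /B li lj cardsT card_prod -mulnn.
rewrite prod_nat_const mul1n -expnM -expnS addn1; congr (_ ^ (2 * _).+1)%N.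
have -> : #|[pred l : 'I_k.+2 | (l != i) && (l != j)]| = #|~: [set i; j]|.
  by apply: eq_card => l; rewrite !inE negb_or.
by have := cardsC [set i; j]; rewrite cards2 ij card_ord; lia.
Qed.

(* A class with det(x_i, x_j) = t != 0 is normalised by the element of SL2
   sending x_i to (1, 0) and x_j to (0, t). *)
Lemma card_classesT_le (F : finFieldType) k :
  (#|cfg_classes k.+1 [set: F * F]| <= (k.+2 ^ 2 + 1) * #|F| ^ (2 * k + 1))%N.
Proof.
pose h (x : config F k.+1) := [set y in configs k.+1 [set: F * F] | cfg_equiv x y].
pose D := [set p : ('I_k.+2 * 'I_k.+2) * config F k.+1 |
   (p.1 \in [set ij | ij.1 != ij.2]) && (p.2 \in normal_cfg k p.1.1 p.1.2)].
have heq x y : cfg_equiv x y -> h x = h y.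
  move=> /cfg_equivP xy; apply/setP => z; rewrite !inE; congr (_ && _).
  by apply/cfg_equivP/cfg_equivP => H i j; rewrite -H xy.
(* Normal forms over ordered pairs (i, j) account for the factor (k+2)^2; configurations with all
   determinants zero form the single class of the zero configuration, hence the + 1. *)
have sub : cfg_classes k.+1 [set: F * F] \subset
    [set h p.2 | p in D] :|: [set h [ffun=> (0, 0)]].
  apply/fintype.subsetP => _ /imsetP[x _ ->]; rewrite -/(h x).
  have [/existsP[i /existsP[j xij]]|/existsPn no] :=
    boolP [exists i, exists j, det2 (x i) (x j) != 0]; last first.
    rewrite !inE; apply/orP; right; apply/eqP/heq/cfg_equivP => i j.
    have /existsPn/(_ j) := no i; rewrite negbK => /eqP ->.
    by rewrite !ffunE /det2 /= !mul0r subrr.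
  (* These are the coordinates of x_l in the frame (x_i, x_j), the second multiplied by det(x_i,
     x_j) so that all determinants are preserved. *)
  pose y : config F k.+1 :=
    [ffun l => (det2 (x l) (x j) / det2 (x i) (x j), det2 (x i) (x l))].
  have dii (v : F * F) : det2 v v = 0 by rewrite /det2 mulrC subrr.
  rewrite inE; apply/orP; left; apply/imsetP; exists ((i, j), y).
    rewrite !inE /= !ffunE /= divff // !dii mul0r !eqxx /= andbT.
    by apply: contraNneq xij => ->; rewrite dii.
  apply: heq; apply/cfg_equivP => l m; rewrite !ffunE /=.
  move: xij; rewrite /det2 /= => xij; field; exact: xij.
have q0 : (0 < #|F|)%N by apply/card_gt0P; exists 0.
apply: leq_trans (subset_leq_card sub) _.
apply: leq_trans (leq_card_setU _ _).1 _.
rewrite cards1 mulnDl mul1n leq_add //; last by rewrite expn_gt0 q0.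
apply: leq_trans (leq_imset_card _ _) _; rewrite (card_dep_pairs _ _ _ (fun ij => normal_cfg k ij.1 ij.2)).
rewrite (eq_bigr (fun=> (#|F| ^ (2 * k + 1))%N)); last first.
  by move=> ij; rewrite inE => /card_normal_cfg ->.
rewrite sum_nat_const leq_mul2r; apply/orP; right.
by apply: leq_trans (max_card _) _; rewrite card_prod card_ord.
Qed.

(** * Combining the bounds *)

Lemma expr_le_card_classes (R : realFieldType) (F : finFieldType) k (E E' : {set F * F}) :
  E' \subset E -> 0 \notin E' -> (2 * #|F| <= #|E'|)%N ->
  #|F|%:R ^+ (2 * k + 3) <= #|E'|%:R ^+ k.+2 :> R ->
  #|F|%:R ^+ (2 * k + 1) <= 4 * (2 ^+ k.+2 + 8) * #|cfg_classes k.+1 E|%:R :> R.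
Proof.
move=> sE E0 h2q hE.
have q0 : (0 < #|F|)%N by apply/card_gt0P; exists 0.
have hS := sum_card_hits_exp R F _ k E0 hE.
have := card_good_sqr_le F k E E' sE.
rewrite -(ler_nat R) natrX natrM natr_sum.
under [X in _ * X]eq_bigr do rewrite natrX.
have := card_good F k _ E0 h2q; rewrite -(ler_nat R) natrX natrM.
move: hS hE.
set S : R := \sum_(g in SL2 F) _; set m : R := #|E'|%:R; set q : R := #|F|%:R.
set G : R := #|good k _|%:R; set c : R := #|cfg_classes _ _|%:R.
rewrite (_ : (2 * k.+2 = k.+2 * 2)%N) ?[m ^+ (_ * _)]exprM; last exact: mulnC.
have [A AE] : exists A, A = 2 ^+ k.+2 + 8 :> R by eexists.
have [M ME] : exists M, M = m ^+ k.+2 by eexists.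
have [Q QE] : exists Q, Q = q ^+ (2 * k + 1) by eexists.
rewrite -AE -ME -QE => hS hE hM hG.
have q1 : 0 < q by rewrite ltr0n.
have Q0 : 0 < Q by rewrite QE exprn_gt0.
have M0 : 0 < M by apply: lt_le_trans hE; rewrite exprn_gt0.
have c0 : 0 <= c by [].
(* The chain is M^2 <= 4 G^2 <= 4 c S <= 4 c A M^2/Q, the 4 being the square of the factor lost in
   [card_good]. Cancelling M^2/Q gives the claim. *)
have M2 : M ^+ 2 <= 4 * (c * (A * (M ^+ 2 / Q))).
  apply: le_trans (_ : 4 * (c * S) <= _); last by rewrite ler_pM2l // ler_wpM2l.
  by apply: le_trans (_ : 4 * G ^+ 2 <= _); [nra | rewrite ler_pM2l].
have MQ0 : 0 < M ^+ 2 / Q by rewrite divr_gt0 ?exprn_gt0.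
rewrite -(ler_pM2r MQ0) mulrCA divff ?gt_eqF // mulr1.
by apply: le_trans M2 _; rewrite le_eqVlt; apply/orP; left; apply/eqP; ring.
Qed.

Theorem theorem1 (R : realType) (k : nat) (hk : (1 <= k)%N) :
  exists C : R, exists c : R, 0 < C /\ 0 < c /\
    forall (F : finFieldType), odd #|F| ->
    forall E : {set F * F},
      C * (#|F|%:R : R) `^ (2 - 1 / (k.+1)%:R) <= (#|E|%:R : R) ->
      c * (#|cfg_classes k [set: F * F]|%:R : R) <= (#|cfg_classes k E|%:R : R).
Proof.
(* From here on configurations have n = k + 2 points. *)
case: k hk => // k _.
have A0 : 0 < 4 * (2 ^+ k.+2 + 8) :> R by rewrite mulr_gt0 ?addr_gt0 ?exprn_gt0.
have B0 : 0 < (k.+2 ^ 2 + 1)%:R :> R by rewrite ltr0n addn1.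
(* With P the power of q in the hypothesis and P >= q >= 1, removing the origin leaves m >= 4 P - 1,
   which exceeds both P and 2 q. The second witness inverts the product of the constants of the
   lower and upper bounds on classes. *)
exists 4, ((4 * (2 ^+ k.+2 + 8)) * (k.+2 ^ 2 + 1)%:R)^-1; split => //.
split; first by rewrite invr_gt0 mulr_gt0.
move=> F _ E hE.
rewrite ler_pdivrMl ?mulr_gt0 // mulrAC.
apply: le_trans (_ : (k.+2 ^ 2 + 1)%:R * #|F|%:R ^+ (2 * k + 1) <= _).
  by rewrite -natrX -natrM ler_nat card_classesT_le.
rewrite [leRHS]mulrC ler_pM2l //.
move: hE; set q : R := #|F|%:R; set P := q `^ _ => hE.
have q1 : 1 <= q by rewrite ler1n; apply/card_gt0P; exists 0.
have q_ge0 : 0 <= q by [].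
have n0 : 0 < k.+2%:R :> R by rewrite ltr0n.
have n1 : 1 / k.+2%:R <= 1 :> R by rewrite ler_pdivrMr // mul1r ler1n.
have qP : q <= P.
  rewrite -[leLHS]powRr1 ?ler_powR //; move: n1; set u := 1 / _ => n1; lra.
(* The critical exponent: n (2 - 1/n) = 2 n - 1 = 2 k + 3, which is what [expr_le_card_classes]
   requires. *)
have PE : P ^+ k.+2 = q ^+ (2 * k + 3).
  rewrite -(powR_mulrn _ q_ge0) -powR_mulrn ?powR_ge0 //.
  rewrite -powRrM; congr (_ `^ _).
  rewrite mulrBl mul1r mulVf ?gt_eqF //.
  by rewrite (_ : (2 * k + 3 = 2 * k.+2 - 1)%N) ?natrB ?natrM //; lia.
have hm : #|E|%:R <= #|E :\ (0 : F * F)|%:R + 1 :> R.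
  by rewrite natr1 ler_nat (cardsD1 (0 : F * F) E) addnC -addn1 leq_add2l leq_b1.
apply: (@expr_le_card_classes _ _ _ _ (E :\ (0 : F * F))).
- exact: subsetDl.
- by rewrite !inE eqxx.
- by rewrite -(ler_nat R) natrM; lra.
- rewrite -/q -PE lerXn2r ?nnegrE ?powR_ge0 //; lra.
Qed.
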